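(* Let $u:A\to B$ be a ring morphism of finite type (i.e. $B$ is a finitely generated $A$-algebra via $u$) that is a strong PSI-morphism. Then $u$ is an epimorphism.
   Context: All rings are commutative and unitary, and ring morphisms are unitary. For $P\in\mathrm{Spec}(A)$, $k_A(P)=A_P/PA_P$ denotes the residue field of $A$ at $P$. A ring morphism $u:A\to B$ is a strong PSI-morphism if for every $P\in\mathrm{Spec}(A)$ with $k_A(P)\otimes_A B\neq 0$, the canonical map $k_A(P)\to k_A(P)\otimes_A B$ is an isomorphism. The morphism $u$ is an epimorphism if the canonical multiplication map $B\otimes_A B\to B$ is an isomorphism. *)

(* Defs.v *)
From HB Require Import structures.
From mathcomp Require Import all_boot all_algebra.
From mathcomp Require Import boolp ring.

Set Implicit Arguments.
Unset Strict Implicit.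
Unset Printing Implicit Defensive.

Import GRing.Theory.
Local Open Scope ring_scope.
Local Open Scope quotient_scope.

(* Rings are [comPzRingType]s, so that the zero ring is allowed.  The library  *)
(* predicate [prime_idealr] is restricted to nonzero rings, hence this record. *)
Record Spec (A : comPzRingType) := PrimeIdeal {
  prime_ideal :> A -> bool;
  prime_ideal0 : prime_ideal 0;
  prime_idealD : forall a b, prime_ideal a -> prime_ideal b ->
                   prime_ideal (a + b);
  prime_idealMl : forall a b, prime_ideal b -> prime_ideal (a * b);
  prime_ideal1 : ~~ prime_ideal 1;
  prime_idealM : forall a b, prime_ideal (a * b) ->
                   prime_ideal a || prime_ideal b }.

Section Localization.
Variables (A : comPzRingType) (P : Spec A).

Lemma prime_idealCM (s t : A) : ~~ P s -> ~~ P t -> ~~ P (s * t).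
Proof.
by move=> Ps Pt; apply/negP => /prime_idealM /orP[]; apply/negP.
Qed.

Definition denom := {s : A | ~~ P s}.
Definition denom1 : denom := exist _ 1 (prime_ideal1 P).
Definition denomM (s t : denom) : denom :=
  exist _ (sval s * sval t) (prime_idealCM (svalP s) (svalP t)).

Definition frac_equiv (x y : A * denom) : bool :=
  `[< exists r : denom, sval r * (x.1 * sval y.2) = sval r * (y.1 * sval x.2) >].

Lemma frac_equiv_is_equiv : equiv_class_of frac_equiv.
Proof.
split=> [x|x y|y x z]; first by apply/asboolP; exists denom1.
  by apply/asboolP/asboolP => -[t e]; exists t.
move=> /asboolP[t e] /asboolP[t' e']; apply/asboolP.
exists (denomM (denomM t t') y.2) => /=.
transitivity (sval t' * sval z.2 * (sval t * (x.1 * sval y.2))); first by ring.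
rewrite e.
transitivity (sval t * sval x.2 * (sval t' * (y.1 * sval z.2))); first by ring.
by rewrite e'; ring.
Qed.

Canonical frac_equiv_equiv := EquivRelPack frac_equiv_is_equiv.
Canonical frac_equiv_encModRel := defaultEncModRel frac_equiv.

Definition localization := {eq_quot frac_equiv}.
HB.instance Definition _ := Choice.on localization.
HB.instance Definition _ := EqQuotient.on localization.

Definition loc_frac (a : A) (s : denom) : localization :=
  \pi_localization (a, s).

Lemma loc_fracP a s b t :
  loc_frac a s = loc_frac b t <->
  exists r : denom, sval r * (a * sval t) = sval r * (b * sval s).
Proof.
split=> [/eqmodP /asboolP //|e].
by apply/eqmodP; apply/asboolP.
Qed.

Lemma loc_fracW (Q : localization -> Prop) :
  (forall a s, Q (loc_frac a s)) -> forall x, Q x.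
Proof. by move=> q; elim/quotW => -[a s]; apply: q. Qed.

Lemma frac_repr x : loc_frac (repr x).1 (repr x).2 = x.
Proof. by rewrite /loc_frac -surjective_pairing reprK. Qed.

Definition loc_add (x y : localization) : localization :=
  loc_frac ((repr x).1 * sval (repr y).2 + (repr y).1 * sval (repr x).2)
       (denomM (repr x).2 (repr y).2).
Definition loc_opp (x : localization) : localization :=
  loc_frac (- (repr x).1) (repr x).2.
Definition loc_mul (x y : localization) : localization :=
  loc_frac ((repr x).1 * (repr y).1) (denomM (repr x).2 (repr y).2).

Lemma loc_addE a s b t :
  loc_add (loc_frac a s) (loc_frac b t) = loc_frac (a * sval t + b * sval s) (denomM s t).
Proof.
have /loc_fracP[r e] := frac_repr (loc_frac a s).
have /loc_fracP[q f] := frac_repr (loc_frac b t).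
apply/loc_fracP; exists (denomM r q) => /=; move: e f.
set x := repr _; set y := repr _ => e f.
transitivity (sval q * sval y.2 * sval t * (sval r * (x.1 * sval s))
            + sval r * sval x.2 * sval s * (sval q * (y.1 * sval t))); first by ring.
by rewrite e f; ring.
Qed.

Lemma loc_oppE a s : loc_opp (loc_frac a s) = loc_frac (- a) s.
Proof.
have /loc_fracP[r e] := frac_repr (loc_frac a s).
by apply/loc_fracP; exists r; rewrite !mulNr !mulrN e.
Qed.

Lemma loc_mulE a s b t :
  loc_mul (loc_frac a s) (loc_frac b t) = loc_frac (a * b) (denomM s t).
Proof.
have /loc_fracP[r e] := frac_repr (loc_frac a s).
have /loc_fracP[q f] := frac_repr (loc_frac b t).
apply/loc_fracP; exists (denomM r q) => /=; move: e f.
set x := repr _; set y := repr _ => e f.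
transitivity ((sval r * (x.1 * sval s)) * (sval q * (y.1 * sval t))); first by ring.
by rewrite e f; ring.
Qed.

Local Lemma frac_eq a s b t :
  a * sval t = b * sval s -> loc_frac a s = loc_frac b t.
Proof. by move=> e; apply/loc_fracP; exists denom1; rewrite e. Qed.

Local Lemma loc_addA : associative loc_add.
Proof.
elim/loc_fracW=> a s; elim/loc_fracW=> b t; elim/loc_fracW=> c r.
by rewrite !loc_addE; apply: frac_eq => /=; ring.
Qed.

Local Lemma loc_addC : commutative loc_add.
Proof.
elim/loc_fracW=> a s; elim/loc_fracW=> b t.
by rewrite !loc_addE; apply: frac_eq => /=; ring.
Qed.

Local Lemma loc_add0 : left_id (loc_frac 0 denom1) loc_add.
Proof.
by elim/loc_fracW=> a s; rewrite loc_addE; apply: frac_eq => /=; ring.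
Qed.

Local Lemma loc_addN : left_inverse (loc_frac 0 denom1) loc_opp loc_add.
Proof.
elim/loc_fracW=> a s.
by rewrite loc_oppE loc_addE; apply: frac_eq => /=; ring.
Qed.

HB.instance Definition _ :=
  GRing.isZmodule.Build localization loc_addA loc_addC loc_add0 loc_addN.

Local Lemma loc_mulA : associative loc_mul.
Proof.
elim/loc_fracW=> a s; elim/loc_fracW=> b t; elim/loc_fracW=> c r.
by rewrite !loc_mulE; apply: frac_eq => /=; ring.
Qed.

Local Lemma loc_mulC : commutative loc_mul.
Proof.
elim/loc_fracW=> a s; elim/loc_fracW=> b t.
by rewrite !loc_mulE; apply: frac_eq => /=; ring.
Qed.

Local Lemma loc_mul1 : left_id (loc_frac 1 denom1) loc_mul.
Proof.
by elim/loc_fracW=> a s; rewrite loc_mulE; apply: frac_eq => /=; ring.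
Qed.

Local Lemma loc_mulDl : left_distributive loc_mul loc_add.
Proof.
elim/loc_fracW=> a s; elim/loc_fracW=> b t; elim/loc_fracW=> c r.
by rewrite !(loc_mulE, loc_addE); apply: frac_eq => /=; ring.
Qed.

Local Lemma loc_1neq0 : loc_frac 1 denom1 != loc_frac 0 denom1.
Proof.
apply/eqP => /loc_fracP[r] /=; rewrite !mul0r !mulr0 !mulr1 => r0.
by have := svalP r; rewrite /= r0 prime_ideal0.
Qed.

HB.instance Definition _ := GRing.Zmodule_isComNzRing.Build localization
  loc_mulA loc_mulC loc_mul1 loc_mulDl loc_1neq0.

Lemma loc_fracD a s b t :
  loc_frac a s + loc_frac b t = loc_frac (a * sval t + b * sval s) (denomM s t).
Proof. exact: loc_addE. Qed.

Lemma loc_fracN a s : - loc_frac a s = loc_frac (- a) s.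
Proof. exact: loc_oppE. Qed.

Lemma loc_fracM a s b t : loc_frac a s * loc_frac b t = loc_frac (a * b) (denomM s t).
Proof. exact: loc_mulE. Qed.

Definition loc_map (a : A) : localization := loc_frac a denom1.

Local Lemma loc_map_is_zmod_morphism : zmod_morphism loc_map.
Proof.
by move=> a b; rewrite /loc_map loc_fracN loc_fracD; apply: frac_eq => /=; ring.
Qed.

Local Lemma loc_map_is_monoid_morphism : monoid_morphism loc_map.
Proof.
by split=> // a b; rewrite /loc_map loc_fracM; apply: frac_eq => /=; ring.
Qed.

HB.instance Definition _ := GRing.isZmodMorphism.Build A localization loc_map
  loc_map_is_zmod_morphism.
HB.instance Definition _ := GRing.isMonoidMorphism.Build A localization loc_map
  loc_map_is_monoid_morphism.

(* The extended ideal P A_P. *)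
Definition loc_ideal (x : localization) : bool :=
  `[< exists2 s : seq (localization * A),
        all (fun p => P p.2) s & x = \sum_(p <- s) p.1 * loc_map p.2 >].

Lemma loc_idealP x :
  reflect (exists a s, P a /\ x = loc_frac a s) (loc_ideal x).
Proof.
apply: (iffP (asboolP _)) => [[l] |[a [s [Pa ->]]]].
  elim: l x => [|[y a] l IH] x /=.
    rewrite big_nil => _ ->; exists 0, denom1; split=> //.
    exact: prime_ideal0.
  case/andP=> Pa Pl; rewrite big_cons /=.
  have [b [t [Pb ->]]] := IH _ Pl erefl.
  elim/loc_fracW: y => c r ->; rewrite /loc_map loc_fracM loc_fracD.
  do 2!eexists; split; last by [].
  by apply: prime_idealD; rewrite mulrC; do !apply: prime_idealMl.
exists [:: (loc_frac 1 s, a)]; first by rewrite /= Pa.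
by rewrite big_seq1 /= /loc_map loc_fracM; apply: frac_eq => /=; ring.
Qed.

Local Lemma loc_ideal_idealr_closed : idealr_closed loc_ideal.
Proof.
split.
- by apply/loc_idealP; exists 0, denom1; split=> //; apply: prime_ideal0.
- apply/negP => /loc_idealP[a [s [Pa /loc_fracP[r]]]] /= e.
  have := prime_idealCM (svalP r) (svalP s).
  move: e; rewrite mul1r mulr1 => /= ->.
  by rewrite prime_idealMl.
- move=> x y z /loc_idealP[a [s [Pa ->]]] /loc_idealP[b [t [Pb ->]]].
  elim/loc_fracW: x => c r; apply/loc_idealP; rewrite loc_fracM loc_fracD.
  do 2!eexists; split; last by [].
  by apply: prime_idealD; rewrite mulrC; do !apply: prime_idealMl.
Qed.

HB.instance Definition _ :=
  isIdealr.Build localization loc_ideal loc_ideal_idealr_closed.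

Definition residue_field := {ideal_quot Idealr.clone localization loc_ideal _}.
HB.instance Definition _ := GRing.ComNzRing.on residue_field.
HB.instance Definition _ := NzRingQuotient.on residue_field.

Definition residue_map (a : A) : residue_field :=
  \pi_residue_field (loc_map a).

Local Lemma residue_map_is_zmod_morphism : zmod_morphism residue_map.
Proof. by move=> a b; rewrite /residue_map rmorphB /= !piE. Qed.

Local Lemma residue_map_is_monoid_morphism : monoid_morphism residue_map.
Proof.
by split=> [|a b]; rewrite /residue_map ?rmorph1 ?rmorphM /= !piE.
Qed.

HB.instance Definition _ := GRing.isZmodMorphism.Build A residue_field
  residue_map residue_map_is_zmod_morphism.
HB.instance Definition _ := GRing.isMonoidMorphism.Build A residue_field
  residue_map residue_map_is_monoid_morphism.

End Localization.

Section Tensor.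
Variables (A R S : comPzRingType).
Variables (f : {rmorphism A -> R}) (g : {rmorphism A -> S}).

(* A formal sum of pure tensors is a sequence of pairs; this is the congruence *)
(* that presents the tensor product of R and S over A.  The rule [tensor_eq0]  *)
(* makes (- x, y) an opposite of (x, y), so that no formal opposite is needed. *)
Inductive tensor_eq : seq (R * S) -> seq (R * S) -> Prop :=
| tensor_eq_refl s : tensor_eq s s
| tensor_eq_sym s t : tensor_eq s t -> tensor_eq t s
| tensor_eq_trans s t r : tensor_eq s t -> tensor_eq t r -> tensor_eq s r
| tensor_eq_cat s s' t t' :
    tensor_eq s s' -> tensor_eq t t' -> tensor_eq (s ++ t) (s' ++ t')
| tensor_eq_catC s t : tensor_eq (s ++ t) (t ++ s)
| tensor_eq0 y : tensor_eq [:: (0, y)] [::]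
| tensor_eqDl x x' y : tensor_eq [:: (x + x', y)] [:: (x, y); (x', y)]
| tensor_eqDr x y y' : tensor_eq [:: (x, y + y')] [:: (x, y); (x, y')]
| tensor_eqA a x y : tensor_eq [:: (f a * x, y)] [:: (x, g a * y)].

Definition tensor_equiv (s t : seq (R * S)) : bool := `[< tensor_eq s t >].

Lemma tensor_equiv_is_equiv : equiv_class_of tensor_equiv.
Proof.
split=> [s|s t|t s r]; first exact/asboolP/tensor_eq_refl.
  by apply/asboolP/asboolP; apply: tensor_eq_sym.
by move=> /asboolP st /asboolP tr; apply/asboolP/(tensor_eq_trans st tr).
Qed.

Canonical tensor_equiv_equiv := EquivRelPack tensor_equiv_is_equiv.
Canonical tensor_equiv_encModRel := defaultEncModRel tensor_equiv.

Definition tensor := {eq_quot tensor_equiv}.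
HB.instance Definition _ := Choice.on tensor.
HB.instance Definition _ := EqQuotient.on tensor.

Local Notation pi s := (\pi_tensor s).

Lemma tensorP s t : pi s = pi t <-> tensor_eq s t.
Proof.
by split=> [/eqmodP /asboolP //|e]; apply/eqmodP/asboolP.
Qed.

Lemma tensorW (Q : tensor -> Prop) : (forall s, Q (pi s)) -> forall x, Q x.
Proof. by move=> q; apply: quotW. Qed.

Local Lemma tensor_eq_repr s : tensor_eq (repr (pi s)) s.
Proof. by apply/tensorP; rewrite reprK. Qed.

Definition tensor_opp_seq (s : seq (R * S)) := [seq (- p.1, p.2) | p <- s].
Definition tensor_mul_seq (s t : seq (R * S)) :=
  [seq (p.1 * q.1, p.2 * q.2) | p <- s, q <- t].

Definition tensor_add (x y : tensor) : tensor := pi (repr x ++ repr y).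
Definition tensor_opp (x : tensor) : tensor := pi (tensor_opp_seq (repr x)).
Definition tensor_mul (x y : tensor) : tensor :=
  pi (tensor_mul_seq (repr x) (repr y)).

Lemma tensor_eq_perm s t : perm_eq s t -> tensor_eq s t.
Proof.
elim: s t => [|p s IH] t; first by rewrite perm_sym => /perm_nilP->; constructor.
move=> e; have /path.splitPr pt : p \in t.
  by rewrite -(perm_mem e) mem_head.
case: pt e => t1 t2; rewrite perm_sym -cat1s perm_catCA /= perm_cons perm_sym.
move=> /IH e; apply: tensor_eq_trans (tensor_eq_cat (tensor_eq_refl [:: p]) e) _.
rewrite -(cat1s p t2) !catA; apply: tensor_eq_cat (tensor_eq_refl _).
exact: tensor_eq_catC.
Qed.

Local Lemma tensor_addE s t : tensor_add (pi s) (pi t) = pi (s ++ t).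
Proof. by apply/tensorP/tensor_eq_cat; apply: tensor_eq_repr. Qed.

Local Lemma tensor_eq_opp s t :
  tensor_eq s t -> tensor_eq (tensor_opp_seq s) (tensor_opp_seq t).
Proof.
elim=> {s t} /=.
- by move=> s; apply: tensor_eq_refl.
- by move=> s t _; apply: tensor_eq_sym.
- by move=> s t r _ st _; apply: tensor_eq_trans st.
- by move=> s s' t t' _ es _ et; rewrite /tensor_opp_seq !map_cat;
     apply: tensor_eq_cat.
- by move=> s t; rewrite /tensor_opp_seq !map_cat; apply: tensor_eq_catC.
- by move=> y; rewrite oppr0; apply: tensor_eq0.
- by move=> x x' y; rewrite opprD; apply: tensor_eqDl.
- by move=> x y y'; apply: tensor_eqDr.
- by move=> a x y; rewrite -mulrN; apply: tensor_eqA.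
Qed.

Local Lemma tensor_oppE s : tensor_opp (pi s) = pi (tensor_opp_seq s).
Proof. exact/tensorP/tensor_eq_opp/tensor_eq_repr. Qed.

Local Lemma tensor_eq_mulp s t p : tensor_eq s t ->
  tensor_eq [seq (q.1 * p.1, q.2 * p.2) | q <- s]
            [seq (q.1 * p.1, q.2 * p.2) | q <- t].
Proof.
elim=> {s t} /=.
- by move=> s; apply: tensor_eq_refl.
- by move=> s t _; apply: tensor_eq_sym.
- by move=> s t r _ st _; apply: tensor_eq_trans st.
- by move=> s s' t t' _ es _ et; rewrite !map_cat; apply: tensor_eq_cat.
- by move=> s t; rewrite !map_cat; apply: tensor_eq_catC.
- by move=> y; rewrite mul0r; apply: tensor_eq0.
- by move=> x x' y; rewrite mulrDl; apply: tensor_eqDl.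
- by move=> x y y'; rewrite mulrDl; apply: tensor_eqDr.
- by move=> a x y; rewrite -!mulrA; apply: tensor_eqA.
Qed.

Local Lemma tensor_mul_seqC s t :
  tensor_eq (tensor_mul_seq s t) (tensor_mul_seq t s).
Proof.
apply: tensor_eq_perm; elim: s => [|p s IH] /=.
  by rewrite /tensor_mul_seq allpairs0r.
rewrite perm_sym /tensor_mul_seq (perm_allpairs_consr _ _ (fun=> p)).
rewrite perm_sym; apply: perm_cat IH; set l := map _ _; set l' := map _ _.
suff -> : l = l' by [].
by apply: eq_map => q; rewrite mulrC [q.2 * _]mulrC.
Qed.

Local Lemma tensor_eq_mull s s' t :
  tensor_eq s s' -> tensor_eq (tensor_mul_seq s t) (tensor_mul_seq s' t).
Proof.
move=> e; apply: tensor_eq_trans (tensor_mul_seqC _ _) _.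
apply: tensor_eq_trans (tensor_mul_seqC _ _); rewrite /tensor_mul_seq.
elim: t => [|p t IH] /=; first exact: tensor_eq_refl.
apply: tensor_eq_cat IH.
have mE r : [seq (p.1 * q.1, p.2 * q.2) | q <- r]
          = [seq (q.1 * p.1, q.2 * p.2) | q <- r].
  by apply: eq_map => q; rewrite mulrC [p.2 * _]mulrC.
by rewrite !mE; apply: tensor_eq_mulp.
Qed.

Local Lemma tensor_mulE s t :
  tensor_mul (pi s) (pi t) = pi (tensor_mul_seq s t).
Proof.
apply/tensorP.
apply: tensor_eq_trans (tensor_eq_mull _ (tensor_eq_repr s)) _.
apply: tensor_eq_trans (tensor_mul_seqC _ _) _.
apply: tensor_eq_trans (tensor_mul_seqC _ _).
exact: tensor_eq_mull (tensor_eq_repr t).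
Qed.

Local Lemma tensor_addA : associative tensor_add.
Proof.
by elim/tensorW=> s; elim/tensorW=> t; elim/tensorW=> r; rewrite !tensor_addE catA.
Qed.

Local Lemma tensor_addC : commutative tensor_add.
Proof.
elim/tensorW=> s; elim/tensorW=> t; rewrite !tensor_addE.
exact/tensorP/tensor_eq_catC.
Qed.

Local Lemma tensor_add0 : left_id (pi [::]) tensor_add.
Proof. by elim/tensorW=> s; rewrite tensor_addE. Qed.

Local Lemma tensor_addN : left_inverse (pi [::]) tensor_opp tensor_add.
Proof.
elim/tensorW=> s; rewrite tensor_oppE tensor_addE.
elim: s => [|[x y] s IH] //=; apply/tensorP.
have {}IH : tensor_eq (tensor_opp_seq s ++ s) [::] by apply/tensorP.
rewrite -[[::]]/([::] ++ [::]).
apply: tensor_eq_trans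
  (_ : tensor_eq ([:: (- x, y); (x, y)] ++ (tensor_opp_seq s ++ s)) _).
  apply: tensor_eq_perm; rewrite /= perm_cons.
  by rewrite -cat1s perm_catCA.
apply: tensor_eq_cat IH; apply: tensor_eq_trans (tensor_eq_sym (tensor_eqDl _ _ _)) _.
by rewrite addNr; apply: tensor_eq0.
Qed.

HB.instance Definition _ := GRing.isZmodule.Build tensor
  tensor_addA tensor_addC tensor_add0 tensor_addN.

Local Lemma tensor_mulC : commutative tensor_mul.
Proof.
elim/tensorW=> s; elim/tensorW=> t; rewrite !tensor_mulE.
exact/tensorP/tensor_mul_seqC.
Qed.

Local Lemma tensor_mulDl : left_distributive tensor_mul tensor_add.
Proof.
elim/tensorW=> s; elim/tensorW=> t; elim/tensorW=> r.
by rewrite !(tensor_mulE, tensor_addE) /tensor_mul_seq allpairs_cat.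
Qed.

Local Lemma tensor_mulA : associative tensor_mul.
Proof.
elim/tensorW=> s; elim/tensorW=> t; elim/tensorW=> r; rewrite !tensor_mulE.
congr (\pi _); elim: s => [|p s IH] //=.
rewrite {1}/tensor_mul_seq /= -/(tensor_mul_seq s (tensor_mul_seq t r)) IH.
rewrite {4}/tensor_mul_seq allpairs_cat; congr (_ ++ _).
rewrite /tensor_mul_seq map_allpairs allpairs_mapl.
by apply: eq_allpairs => q q' /=; rewrite !mulrA.
Qed.

Local Lemma tensor_mul1 : left_id (pi [:: (1, 1)]) tensor_mul.
Proof.
elim/tensorW=> s; rewrite tensor_mulE; congr (\pi _).
rewrite /tensor_mul_seq allpairs1l -[RHS]map_id; apply: eq_map => -[x y] /=.
by rewrite !mul1r.
Qed.

HB.instance Definition _ := GRing.Zmodule_isComPzRing.Build tensor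
  tensor_mulA tensor_mulC tensor_mul1 tensor_mulDl.

Definition pure_tensor (x : R) (y : S) : tensor := pi [:: (x, y)].

Lemma pure_tensorDl x x' y :
  pure_tensor (x + x') y = pure_tensor x y + pure_tensor x' y.
Proof. by rewrite [RHS]tensor_addE; apply/tensorP/tensor_eqDl. Qed.

Lemma pure_tensorDr x y y' :
  pure_tensor x (y + y') = pure_tensor x y + pure_tensor x y'.
Proof. by rewrite [RHS]tensor_addE; apply/tensorP/tensor_eqDr. Qed.

Lemma pure_tensorA a x y : pure_tensor (f a * x) y = pure_tensor x (g a * y).
Proof. exact/tensorP/tensor_eqA. Qed.

Lemma pure_tensorN x y : pure_tensor (- x) y = - pure_tensor x y.
Proof. by rewrite [RHS]tensor_oppE. Qed.

Lemma pure_tensorM x y x' y' :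
  pure_tensor x y * pure_tensor x' y' = pure_tensor (x * x') (y * y').
Proof. exact: tensor_mulE. Qed.

Lemma pure_tensor11 : pure_tensor 1 1 = 1.
Proof. by []. Qed.

Lemma tensor_sum s : pi s = \sum_(p <- s) pure_tensor p.1 p.2.
Proof.
elim: s => [|[x y] s IH]; first by rewrite big_nil.
by rewrite big_cons -IH [RHS]tensor_addE.
Qed.

Definition tensor_inl (x : R) : tensor := pure_tensor x 1.

Local Lemma tensor_inl_is_zmod_morphism : zmod_morphism tensor_inl.
Proof. by move=> x y; rewrite /tensor_inl pure_tensorDl pure_tensorN. Qed.

Local Lemma tensor_inl_is_monoid_morphism : monoid_morphism tensor_inl.
Proof. by split=> // x y; rewrite /tensor_inl pure_tensorM mul1r. Qed.

HB.instance Definition _ := GRing.isZmodMorphism.Build R tensor tensor_inl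
  tensor_inl_is_zmod_morphism.
HB.instance Definition _ := GRing.isMonoidMorphism.Build R tensor tensor_inl
  tensor_inl_is_monoid_morphism.

Section Lift.
Variables (T : comPzRingType) (h : {rmorphism R -> T}) (k : {rmorphism S -> T}).

Definition tensor_lift of (forall a, h (f a) = k (g a)) :=
  fun z : tensor => \sum_(p <- repr z) h p.1 * k p.2.

Hypothesis hk : forall a, h (f a) = k (g a).
Local Notation lift := (tensor_lift hk).

Local Lemma tensor_eq_lift s t : tensor_eq s t ->
  \sum_(p <- s) h p.1 * k p.2 = \sum_(p <- t) h p.1 * k p.2.
Proof.
elim=> {s t}.
- by [].
- by move=> s t _ ->.
- by move=> s t r _ -> _ ->.
- by move=> s s' t t' _ es _ et; rewrite !big_cat /= es et.
- by move=> s t; rewrite !big_cat /= addrC.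
- by move=> y; rewrite big_seq1 big_nil /= rmorph0 mul0r.
- by move=> x x' y; rewrite !big_cons !big_nil !addr0 /= rmorphD mulrDl.
- by move=> x y y'; rewrite !big_cons !big_nil !addr0 /= rmorphD mulrDr.
- by move=> a x y; rewrite !big_seq1 /= !rmorphM hk mulrCA mulrA.
Qed.

Local Lemma tensor_liftE s : lift (pi s) = \sum_(p <- s) h p.1 * k p.2.
Proof. exact: tensor_eq_lift (tensor_eq_repr s). Qed.

Lemma tensor_lift_pure x y : lift (pure_tensor x y) = h x * k y.
Proof. by rewrite tensor_liftE big_seq1. Qed.

Local Lemma tensor_lift_is_zmod_morphism : zmod_morphism lift.
Proof.
elim/tensorW=> s; elim/tensorW=> t.
rewrite [- _]tensor_oppE [_ + _]tensor_addE !tensor_liftE big_cat big_map /=.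
by rewrite -sumrN; congr (_ + _); apply: eq_bigr => p _; rewrite rmorphN mulNr.
Qed.

Local Lemma tensor_lift_is_monoid_morphism : monoid_morphism lift.
Proof.
split; first by rewrite tensor_lift_pure !rmorph1 mulr1.
elim/tensorW=> s; elim/tensorW=> t.
rewrite [_ * _]tensor_mulE !tensor_liftE big_allpairs_dep mulr_suml.
apply: eq_bigr => p _; rewrite mulr_sumr; apply: eq_bigr => q _ /=.
by rewrite !rmorphM mulrACA.
Qed.

HB.instance Definition _ := GRing.isZmodMorphism.Build tensor T lift
  tensor_lift_is_zmod_morphism.
HB.instance Definition _ := GRing.isMonoidMorphism.Build tensor T lift
  tensor_lift_is_monoid_morphism.

End Lift.

End Tensor.

Section Morphisms.
Variables (A B : comPzRingType) (u : {rmorphism A -> B}).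

(* The only A-subalgebra of B containing s is B itself. *)
Definition finite_type : Prop :=
  exists s : seq B, forall C : {pred B},
    GRing.subring_closed C -> (forall a, u a \in C) -> {subset s <= C} ->
    forall b, b \in C.

Definition strong_PSI : Prop :=
  forall P : Spec A,
    (exists z : tensor (residue_map P) u, z != 0) ->
    bijective (tensor_inl (residue_map P) u).

Definition tensor_mult : tensor u u -> B :=
  @tensor_lift A B B u u B idfun idfun (fun=> erefl).
HB.instance Definition _ := GRing.RMorphism.on tensor_mult.

Lemma tensor_mult_pure b c : tensor_mult (pure_tensor u u b c) = b * c.
Proof. exact: tensor_lift_pure. Qed.

Definition epimorphism : Prop := bijective tensor_mult.

End Morphisms.

Arguments tensor_mult {A B} u z.

(* Main.v *)
From HB Require Import structures.
Require Import Defs.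
From mathcomp Require Import all_boot fingroup perm generic_quotient all_algebra.
From mathcomp Require Import boolp classical_sets ring.

(** Let T = B (x)_A B and d b = b (x) 1 - 1 (x) b.  The map d is an A-linear
    derivation, it vanishes on A, and u is an epimorphism as soon as d = 0
    ([epimorphism_of_tensor_diff]).  Since B is generated over A by finitely
    many b_i, every d b is a T-linear combination of the d b_i
    ([tensor_diff_generated]); so it is enough that the ideal I spanned by the
    d b_i is zero.  That is a local question: the annihilator of I is an ideal,
    and it is all of T unless some prime Q of T contains it
    ([exists_prime_ideal_over]).

    Fix a prime Q of T, lying over the prime P of A.  The fibre of u at P is
    nonzero because Q lies over P ([fiber_neq0]), hence, u being a strong
    PSI-morphism, k(P) maps onto it.  Thus
    every b in B is congruent to a fraction a / t modulo P B_P, and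
    d (t b) = d (t b - a) lies in P I after localization at Q
    ([strong_PSI_span]).  Hence I_Q = P I_Q = Q I_Q, and Nakayama's lemma, in the
    form of the determinant trick ([annihilator_of_matrix_mod_prime]), gives an
    element outside Q that kills I.  So no prime contains the annihilator of I,
    and I = 0.

    The only place where the relations of k(P) (x)_A B have to be analysed is
    [tensor_eq_saturated].  It clears denominators: formal sums of pure tensors
    that are equal in the fibre give fractions of B that are equal modulo J, for
    every A-submodule J of B that contains P B and is stable under division by
    A \ P.  The argument uses it twice: with J a prime of B, for the fibre not
    to vanish, and with J the set of those b for which d b lies in Q I_Q, for the
    key step above. *)
Set Implicit Arguments.
Unset Strict Implicit.
Unset Printing Implicit Defensive.

Import GRing.Theory.
Local Open Scope ring_scope.
Local Open Scope quotient_scope.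

(** * Prime ideals and the determinant trick *)
Section PrimeIdeals.
Variables (R : comPzRingType).
Implicit Types (Q : Spec R) (x y : R).

Lemma prime_idealMr Q x y : Q x -> Q (x * y).
Proof. by rewrite mulrC; apply: prime_idealMl. Qed.

Lemma prime_idealN Q x : Q x -> Q (- x).
Proof. by rewrite -mulN1r; apply: prime_idealMl. Qed.

Lemma prime_idealB Q x y : Q x -> Q y -> Q (x - y).
Proof. by move=> Qx Qy; apply: prime_idealD => //; apply: prime_idealN. Qed.

Lemma prime_idealDr Q x y : Q y -> Q (x + y) -> Q x.
Proof. by move=> Qy Qxy; rewrite -(addrK y x); apply: prime_idealB. Qed.

Lemma prime_ideal_sum Q (I : finType) (D : {pred I}) (F : I -> R) :
  (forall i, i \in D -> Q (F i)) -> Q (\sum_(i in D) F i).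
Proof.
move=> QF; apply: (big_ind (fun x => Q x)) => //; [exact: prime_ideal0 | exact: prime_idealD].
Qed.

Lemma prime_ideal_prodCM Q (I : finType) (F : I -> R) :
  (forall i, ~~ Q (F i)) -> ~~ Q (\prod_i F i).
Proof.
move=> QF; apply: (big_ind (fun x => ~~ Q x)) => //; first exact: prime_ideal1.
exact: prime_idealCM.
Qed.

Record proper_ideal (J : set R) : Prop := ProperIdeal {
  proper_ideal0 : J 0;
  proper_idealD : forall x y, J x -> J y -> J (x + y);
  proper_idealMl : forall x y, J y -> J (x * y);
  proper_ideal1 : ~ J 1 }.

(** Krull's theorem, by Zorn's lemma: an ideal that is maximal among the proper
    ideals containing J is prime. *)
Lemma exists_prime_ideal_over (J : set R) :
  proper_ideal J -> exists Q : Spec R, forall x, J x -> Q x.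
Proof.
move=> idJ; (* Taking the union with J lets the empty chain have the upper bound J. *)
pose P (X : set R) := proper_ideal (J `|` X).
have [F FP totF|X [idX maxX]] := @Zorn_bigcup R P.
  have FD X x y : F X -> (J `|` X)%classic x -> (J `|` X)%classic y ->
      (J `|` \bigcup_(X in F) X)%classic (x + y).
    move=> FX Xx Xy; case: (proper_idealD (FP _ FX) Xx Xy); first by left.
    by right; exists X.
  split.
  - by left; apply: proper_ideal0.
  - move=> x y [Jx|[X FX Xx]] [Jy|[Y FY Yy]].
    + by left; apply: proper_idealD.
    + by apply: FD FY _ _; [left | right].
    + by apply: FD FX _ _; [right | left].
    + have [XY|YX] := totF _ _ FX FY.
        by apply: FD FY _ _; right => //; apply: XY.
      by apply: FD FX _ _; right => //; apply: YX.
  - move=> x y [Jy|[X FX Xy]]; first by left; apply: proper_idealMl.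
    case: (proper_idealMl (FP _ FX) x (or_intror Xy)); first by left.
    by right; exists X.
  - move=> [J1|[X FX X1]]; first exact: proper_ideal1 idJ J1.
    exact: proper_ideal1 (FP _ FX) (or_intror X1).
pose Q := (J `|` X)%classic.
(* By maximality, Q together with any x outside it generates the unit ideal. *)
have genQ x : ~ Q x -> exists q r, Q q /\ q + r * x = 1.
  move=> Qx; pose Y := [set z | exists q r, Q q /\ z = q + r * x]%classic.
  have QY q : Q q -> Y q by exists q, 0; split=> //; ring.
  have XY : (X `<` Y)%classic.
    split=> [z Xz|YX]; first by apply: QY; right.
    apply: Qx; right; apply: YX; exists 0, 1; split; last by ring.
    exact: (proper_ideal0 idX).
  have JY z : (J `|` Y)%classic z -> Y z.
    by case=> // Jz; apply: QY; left.
  apply: contrapT => Y1; apply: (maxX Y XY); split.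
  - by left; apply: proper_ideal0 idJ.
  - move=> y z /JY [q [r [Qq ->]]] /JY [q' [r' [Qq' ->]]]; right.
    exists (q + q'), (r + r'); split; last by ring.
    exact: (proper_idealD idX).
  - move=> y z /JY [q [r [Qq ->]]]; right.
    exists (y * q), (y * r); split; last by ring.
    exact: (proper_idealMl idX).
  - by move=> /JY [q [r [Qq e]]]; apply: Y1; exists q, r.
have Qprime x y : `[< Q (x * y) >] -> `[< Q x >] || `[< Q y >].
  move=> /asboolP Qxy; apply/orP.
  have [Qx|/genQ [q [r [Qq e]]]] := pselect (Q x); first by left; apply/asboolP.
  right; apply/asboolP; rewrite -[y]mul1r -e.
  rewrite (_ : _ * y = y * q + r * (x * y)); last by ring.
  by apply: (proper_idealD idX); apply: (proper_idealMl idX).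
have Q0 : `[< Q 0 >] by apply/asboolP/(proper_ideal0 idX).
have QD x y : `[< Q x >] -> `[< Q y >] -> `[< Q (x + y) >].
  move=> /asboolP Qx /asboolP Qy.
  by apply/asboolP/(proper_idealD idX).
have QM x y : `[< Q y >] -> `[< Q (x * y) >].
  by move=> /asboolP Qy; apply/asboolP/(proper_idealMl idX).
have Q1 : ~~ `[< Q 1 >] by apply/asboolP/(proper_ideal1 idX).
by exists (PrimeIdeal Q0 QD QM Q1 Qprime) => x Jx; apply/asboolP; left.
Qed.

(** Local Nakayama lemma: M is invertible modulo Q, because its determinant is
    there the product of the diagonal entries, while the adjugate matrix shows
    that the determinant kills v. *)
Lemma annihilator_of_matrix_mod_prime Q n (M : 'M[R]_n) (v : 'cV[R]_n) :
  (forall i j, Q (M i j) = (i != j)) -> M *m v = 0 ->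
  exists2 r, ~~ Q r & forall i, r * v i 0 = 0.
Proof.
move=> QM Mv0; exists (\det M); last first.
  move=> i; have : (\adj M *m (M *m v)) i 0 = 0 by rewrite Mv0 mulmx0 mxE.
  by rewrite mulmxA mul_adj_mx mul_scalar_mx mxE.
rewrite /determinant (bigD1 (1%g : {perm 'I_n})) //= odd_perm1 expr0 mul1r.
have diag : ~~ Q (\prod_i M i ((1%g : {perm 'I_n}) i)).
  by apply: prime_ideal_prodCM => i; rewrite perm1 QM eqxx.
apply: contra diag; apply: prime_idealDr; apply: prime_ideal_sum => s s1.
have [i si] : exists i, s i != i.
  apply/existsP; apply: contraNT s1; rewrite negb_exists => /forallP /= fix_s.
  by apply/eqP/permP => i; rewrite perm1; apply/eqP; rewrite -[_ == _]negbK.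
apply: prime_idealMl; rewrite (bigD1 i) //=; apply: prime_idealMr.
by rewrite QM eq_sym.
Qed.

End PrimeIdeals.

Section Comap.
Variables (A R : comPzRingType) (f : {rmorphism A -> R}) (Q : Spec R).

Definition prime_comap : Spec A.
Proof.
apply: (@PrimeIdeal A (fun a => Q (f a))).
- by rewrite rmorph0 prime_ideal0.
- by move=> a b; rewrite rmorphD; apply: prime_idealD.
- by move=> a b; rewrite rmorphM; apply: prime_idealMl.
- by rewrite rmorph1 prime_ideal1.
- by move=> a b; rewrite rmorphM; apply: prime_idealM.
Defined.

End Comap.

(** * Residue fields and fibres *)
Section ResidueFractions.
Variables (A : comPzRingType) (P : Spec A).
Implicit Types (x y : residue_field P) (a : A).

Lemma residue_map_eq0 a : (residue_map P a == 0) = P a.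
Proof.
rewrite -[0](rmorph0 (residue_map P)) /residue_map /=.
rewrite -Quotient.idealrBE -rmorphB subr0 /=.
apply/loc_idealP/idP => [[b [s [Pb /loc_fracP[r /= e]]]]|Pa]; last first.
  by exists a, (denom1 P).
have : P (sval r * (a * sval s)).
  by rewrite e mulr1; apply: prime_idealMl.
move=> /prime_idealM /orP[Pr|/prime_idealM /orP[//|Ps]].
  by have := svalP r; rewrite /= Pr.
by have := svalP s; rewrite /= Ps.
Qed.

Definition res_num x : A := (repr (repr x)).1.
Definition res_den x : A := sval (repr (repr x)).2.

Lemma res_denN x : ~~ P (res_den x).
Proof. exact: svalP (repr (repr x)).2. Qed.

Lemma res_numE x : residue_map P (res_num x) = x * residue_map P (res_den x).
Proof.
rewrite -{2}[x]reprK /residue_map /= -rmorphM /=; congr (\pi _).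
rewrite -[repr x]frac_repr /loc_map loc_fracM.
apply/loc_fracP; exists (denom1 P) => /=; rewrite /res_num /res_den; ring.
Qed.

End ResidueFractions.

Section FiberFractions.
Variables (A B : comPzRingType) (u : {rmorphism A -> B}) (P : Spec A).

(** Inverse images in B of A_P-submodules of B_P that contain P B_P. *)
Record saturated (J : B -> Prop) : Prop := Saturated {
  saturatedD : forall b c, J b -> J c -> J (b + c);
  saturatedZ : forall a b, J b -> J (u a * b);
  saturated_prime : forall p b, P p -> J (u p * b);
  saturatedK : forall t b, ~~ P t -> J (u t * b) -> J b }.

(** The formal sum of the pure tensors (n_i / d_i) (x) b_i stands for the
    fraction of B with denominator the product of the d_i and with numerator the
    sum of the n_i b_i, each multiplied by the d_j for j <> i. *)
Fixpoint fiber_den (s : seq (residue_field P * B)) : A :=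
  if s is p :: s' then res_den p.1 * fiber_den s' else 1.

Fixpoint fiber_num (s : seq (residue_field P * B)) : B :=
  if s is p :: s' then
    u (res_num p.1 * fiber_den s') * p.2 + u (res_den p.1) * fiber_num s'
  else 0.

Lemma fiber_denN s : ~~ P (fiber_den s).
Proof.
elim: s => [|p s IH] /=; first exact: prime_ideal1.
by apply: prime_idealCM => //; apply: res_denN.
Qed.

Lemma fiber_den_cat s t : fiber_den (s ++ t) = fiber_den s * fiber_den t.
Proof. by elim: s => [|p s IH] /=; rewrite ?mul1r // IH mulrA. Qed.

Lemma fiber_num_cat s t :
  fiber_num (s ++ t) = u (fiber_den t) * fiber_num s + u (fiber_den s) * fiber_num t.
Proof.
elim: s => [|p s IH] /=; first by rewrite rmorph1; ring.
by rewrite IH fiber_den_cat; ring.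
Qed.

(** The fraction attached to a formal sum depends, modulo J, only on its class in
    the fibre: equality of fractions modulo J is an equivalence because J is
    saturated, and each relation defining the tensor product changes the
    numerator by a multiple of an element of P. *)
Lemma tensor_eq_saturated (J : B -> Prop) (satJ : saturated J) s t :
  tensor_eq (residue_map P) u s t ->
  J (u (fiber_den t) * fiber_num s - u (fiber_den s) * fiber_num t).
Proof.
have Jres a b : residue_map P a = 0 -> J (u a * b).
  by move=> /eqP; rewrite residue_map_eq0; apply: (saturated_prime satJ).
have J0 : J 0.
  by rewrite -(mul0r 0) -(rmorph0 u); apply: Jres; rewrite rmorph0.
elim=> {s t}.
- by move=> s; rewrite subrr.
- move=> s t _ Jst; rewrite (_ : _ - _ = u (- 1) *
    (u (fiber_den t) * fiber_num s - u (fiber_den s) * fiber_num t)); last by ring.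
  exact: (saturatedZ satJ).
- move=> s t r _ Jst _ Jtr; apply: (saturatedK satJ (fiber_denN t)).
  rewrite (_ : _ * _ =
    u (fiber_den r) * (u (fiber_den t) * fiber_num s - u (fiber_den s) * fiber_num t)
    + u (fiber_den s) * (u (fiber_den r) * fiber_num t - u (fiber_den t) * fiber_num r));
    last by ring.
  by apply: (saturatedD satJ); apply: (saturatedZ satJ).
- move=> s s' t t' _ Js _ Jt; rewrite !fiber_den_cat !fiber_num_cat.
  rewrite (_ : _ - _ = u (fiber_den t * fiber_den t') *
      (u (fiber_den s') * fiber_num s - u (fiber_den s) * fiber_num s')
    + u (fiber_den s * fiber_den s') *
      (u (fiber_den t') * fiber_num t - u (fiber_den t) * fiber_num t'));
    last by ring.
  by apply: (saturatedD satJ); apply: (saturatedZ satJ).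
- move=> s t; rewrite !fiber_den_cat !fiber_num_cat.
  by rewrite (_ : _ - _ = 0) //; ring.
- move=> y /=; rewrite (_ : _ - _ = u (res_num (0 : residue_field P)) * y); last by ring.
  by apply: Jres; rewrite res_numE mul0r.
- move=> x x' y /=.
  rewrite (_ : _ - _ = u (res_num (x + x') * (res_den x * res_den x')
    - res_den (x + x') * (res_num x * res_den x' + res_den x * res_num x')) * y);
    last by ring.
  apply: Jres; rewrite !(rmorphB, rmorphD, rmorphM) /= !res_numE; ring.
- by move=> x y y' /=; rewrite (_ : _ - _ = 0) //; ring.
- move=> a x y /=.
  rewrite (_ : _ - _ = u (res_den x * res_num (residue_map P a * x)
    - res_den (residue_map P a * x) * res_num x * a) * y); last by ring.
  apply: Jres; rewrite !(rmorphB, rmorphM) /= !res_numE; ring.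
Qed.

Lemma res_num1N : ~~ P (res_num (1 : residue_field P)).
Proof. by rewrite -residue_map_eq0 res_numE mul1r residue_map_eq0 res_denN. Qed.

(** A prime of B over P is a saturated submodule without 1, so 1 and 0 have
    different fractions modulo it. *)
Lemma fiber_neq0 (Q : Spec B) :
  (forall a, P a = Q (u a)) -> (1 : tensor (residue_map P) u) != 0.
Proof.
move=> PQ; apply/eqP => /tensorP e.
have satQ : saturated (fun b => Q b).
  split=> [b c|a b|p b Pp|t b Pt].
  - exact: prime_idealD.
  - exact: prime_idealMl.
  - by apply: prime_idealMr; rewrite -PQ.
  - by move=> /prime_idealM; rewrite -PQ (negPf Pt).
have /= := tensor_eq_saturated satQ e.
rewrite (_ : _ - _ = u (res_num (1 : residue_field P))); last by ring.
by rewrite -PQ; apply/negP/res_num1N.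
Qed.

(** If 1 (x) b comes from x in k(P), then clearing denominators in
    x (x) 1 = 1 (x) b shows that b is a fraction of A modulo J. *)
Lemma fraction_mod_saturated (J : B -> Prop) : saturated J ->
  bijective (tensor_inl (residue_map P) u) ->
  forall b, exists s a, ~~ P s /\ J (u s * b - u a).
Proof.
move=> satJ [g _ gK] b; set z := pure_tensor (residue_map P) u 1 b.
have /tensorP/(tensor_eq_saturated satJ) /= := esym (gK z).
set x := g z => Jx.
exists (res_den x * res_num (1 : residue_field P)).
exists (res_den (1 : residue_field P) * res_num x); split.
  exact: prime_idealCM (res_denN x) res_num1N.
rewrite (_ : _ - _ = u (res_den x * 1) *
 (u (res_num (1 : residue_field P) * 1) * b + u (res_den (1 : residue_field P)) * 0) -
  u (res_den (1 : residue_field P) * 1) *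
  (u (res_num x * 1) * 1 + u (res_den x) * 0)) //; ring.
Qed.

End FiberFractions.

(** * The diagonal ideal of the tensor square *)
Section Diagonal.
Variables (A B : comPzRingType) (u : {rmorphism A -> B}).

Local Notation T := (tensor u u).
Local Notation inl := (tensor_inl u u).

Definition tensor_diff (b : B) : T := pure_tensor u u b 1 - pure_tensor u u 1 b.

Lemma tensor_diff_is_zmod_morphism : zmod_morphism tensor_diff.
Proof.
have inrN b : pure_tensor u u 1 (- b) = - pure_tensor u u 1 b.
  apply/eqP; rewrite -addr_eq0 -pure_tensorDr addNr.
  apply/eqP; apply: (addIr (pure_tensor u u 1 0)).
  by rewrite -pure_tensorDr addr0 add0r.
move=> b c; rewrite /tensor_diff pure_tensorDl pure_tensorDr pure_tensorN inrN.
ring.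
Qed.

HB.instance Definition _ :=
  GRing.isZmodMorphism.Build B T tensor_diff tensor_diff_is_zmod_morphism.

Lemma tensor_diffM b c :
  tensor_diff (b * c) = inl b * tensor_diff c + pure_tensor u u 1 c * tensor_diff b.
Proof.
rewrite /tensor_diff /tensor_inl.
rewrite !mulrBr !pure_tensorM !(mulr1, mul1r) [c * b]mulrC; ring.
Qed.

Lemma tensor_diff_base a : tensor_diff (u a) = 0.
Proof.
rewrite /tensor_diff -[X in pure_tensor u u X 1]mulr1 pure_tensorA mulr1.
by rewrite subrr.
Qed.

Lemma tensor_diffZ a b : tensor_diff (u a * b) = inl (u a) * tensor_diff b.
Proof. by rewrite tensor_diffM tensor_diff_base mulr0 addr0. Qed.

(** When b (x) 1 = 1 (x) b for all b, every pure tensor b (x) c is (b c) (x) 1,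
    and so b |-> b (x) 1 is inverse to the multiplication map. *)
Lemma epimorphism_of_tensor_diff : (forall b, tensor_diff b = 0) -> epimorphism u.
Proof.
move=> d0; have inr b : pure_tensor u u 1 b = inl b.
  by apply/esym/eqP; rewrite -subr_eq0; apply/eqP/d0.
exists inl => [|b]; last by rewrite tensor_mult_pure mulr1.
elim/tensorW=> s; rewrite tensor_sum (rmorph_sum (tensor_mult u)) (rmorph_sum inl).
apply: eq_bigr => -[b c] _ /=; rewrite tensor_mult_pure rmorphM /=.
by rewrite -(inr c) /tensor_inl pure_tensorM mulr1 mul1r.
Qed.

Section Generators.
Variables (s : seq B).
Hypothesis gen_s : forall C : {pred B},
  GRing.subring_closed C -> (forall a, u a \in C) -> {subset s <= C} ->
  forall b, b \in C.

Local Notation v i := (tensor_diff (tnth (in_tuple s) i)).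

(** By the Leibniz rule [tensor_diffM], the elements whose image under
    [tensor_diff] lies in the span of the images of the generators form a subring
    containing A and the generators. *)
Lemma tensor_diff_generated b :
  exists q : 'I_(size s) -> T, tensor_diff b = \sum_i q i * v i.
Proof.
pose C : {pred B} := fun b => `[< exists q : 'I_(size s) -> T,
  tensor_diff b = \sum_i q i * v i >].
have in_base a : u a \in C.
  apply/asboolP; exists (fun=> 0); rewrite tensor_diff_base big1 // => i _.
  by rewrite mul0r.
suff /asboolP : b \in C by [].
apply: gen_s => // [|c /seq_tnthP [i ->]]; last first.
  apply/asboolP; exists (fun j => (j == i)%:R).
  by rewrite (bigD1 i) //= eqxx mul1r big1 ?addr0 // => j /negPf->; rewrite mul0r.
split; first by rewrite -(rmorph1 u).
- move=> x y /asboolP [q qx] /asboolP [q' qy].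
  apply/asboolP; exists (fun i => q i - q' i); rewrite raddfB /= qx qy -sumrB.
  by apply: eq_bigr => i _; rewrite mulrBl.
- move=> x y /asboolP [q qx] /asboolP [q' qy]; apply/asboolP.
  exists (fun i => inl x * q' i + pure_tensor u u 1 y * q i).
  rewrite tensor_diffM qx qy !mulr_sumr -big_split /=.
  by apply: eq_bigr => i _; ring.
Qed.

(** The image of b in the localization of the diagonal ideal I at Q lies in
    Q I_Q. *)
Definition locally_in_prime_span (Q : Spec T) (b : B) : Prop :=
  exists r (q : 'I_(size s) -> T), [/\ ~~ Q r, forall i, Q (q i) &
    r * tensor_diff b = \sum_i q i * v i].

(** This holds by A-linearity of [tensor_diff]; P B goes into P I, and thus into
    Q I, because [tensor_diff] takes its values in I. *)
Lemma locally_in_prime_span_saturated (P : Spec A) (Q : Spec T) :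
  (forall a, P a = Q (inl (u a))) -> saturated u P (locally_in_prime_span Q).
Proof.
move=> PQ; split.
- move=> b c [r [q [Qr Qq e]]] [r' [q' [Qr' Qq' e']]].
  exists (r * r'), (fun i => r' * q i + r * q' i).
  split; first exact: prime_idealCM.
    by move=> i; apply: prime_idealD; apply: prime_idealMl.
  transitivity (r' * (r * tensor_diff b) + r * (r' * tensor_diff c)).
    by rewrite raddfD /=; ring.
  rewrite e e' !mulr_sumr -big_split /=.
  by apply: eq_bigr => i _; ring.
- move=> a b [r [q [Qr Qq e]]]; exists r, (fun i => inl (u a) * q i).
  split=> // [i|]; first exact: prime_idealMl.
  rewrite tensor_diffZ mulrCA e mulr_sumr.
  by apply: eq_bigr => i _; rewrite mulrA.
- move=> p b; rewrite PQ => Qp; have [q e] := tensor_diff_generated b.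
  exists 1, (fun i => inl (u p) * q i); split=> [|i|]; first exact: prime_ideal1.
    exact: prime_idealMr.
  rewrite mul1r tensor_diffZ e mulr_sumr.
  by apply: eq_bigr => i _; rewrite mulrA.
- move=> t b; rewrite PQ => Qt [r [q [Qr Qq e]]].
  exists (r * inl (u t)), q; split=> //; first exact: prime_idealCM.
  by rewrite -mulrA -tensor_diffZ.
Qed.

(** The key step, I_Q = Q I_Q.  Writing t b = a modulo the submodule of the
    previous lemma, the element a of A disappears under [tensor_diff] and the
    factor t is invertible at Q. *)
Lemma strong_PSI_span (Q : Spec T) b :
  strong_PSI u -> locally_in_prime_span Q b.
Proof.
move=> psi; pose QB := prime_comap inl Q; pose P := prime_comap u QB.
have satJ : saturated u P (locally_in_prime_span Q).
  exact: locally_in_prime_span_saturated.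
have bij : bijective (tensor_inl (residue_map P) u).
  by apply: psi; exists 1; apply: (@fiber_neq0 _ _ u P QB).
have [t [a [Pt [r [q [Qr Qq e]]]]]] := fraction_mod_saturated satJ bij b.
exists (r * inl (u t)), q; split=> //; first exact: prime_idealCM.
by rewrite -e -mulrA -tensor_diffZ raddfB /= tensor_diff_base subr0.
Qed.

Lemma strong_PSI_annihilator (Q : Spec T) :
  strong_PSI u -> exists2 r, ~~ Q r & forall i, r * v i = 0.
Proof.
move=> psi.
have [r rP] := choice (fun i => strong_PSI_span Q (tnth (in_tuple s) i) psi).
have [q qP] := choice rP.
(* M times the vector of the v i is 0, and M is diagonal modulo Q. *)
pose M : 'M[T]_(size s) := \matrix_(i, j) (r i *+ (i == j) - q i j).
have QM i j : Q (M i j) = (i != j).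
  have [Qr Qq _] := qP i; rewrite mxE; case: eqP => _ /=.
    by apply: contraNF Qr; apply: prime_idealDr; apply: prime_idealN.
  by rewrite sub0r; apply: prime_idealN.
have [|r' Qr' r'0] := @annihilator_of_matrix_mod_prime T Q _ M (\col_i v i) QM.
  apply/matrixP => i k; have [_ _ e] := qP i; rewrite !mxE.
  transitivity (\sum_j (r i *+ (i == j) * v j - q i j * v j)).
    by apply: eq_bigr => j _; rewrite !mxE mulrBl.
  rewrite sumrB -e (bigD1 i) //= eqxx mulr1n big1 ?addr0 ?subrr // => j.
  by rewrite eq_sym => /negPf ->; rewrite mulr0n mul0r.
by exists r' => // i; have := r'0 i; rewrite mxE.
Qed.

Lemma strong_PSI_tensor_diff : strong_PSI u -> forall b, tensor_diff b = 0.
Proof.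
move=> psi; pose I := [set r : T | forall i, r * v i = 0]%classic.
have I1 : I 1.
  apply: contrapT => I1; have [|Q IQ] := @exists_prime_ideal_over T I.
    split=> // [i|x y Ix Iy i|x y Iy i]; first by rewrite mul0r.
      by rewrite mulrDl Ix Iy addr0.
    by rewrite -mulrA Iy mulr0.
  by have [r /negP Qr /IQ] := strong_PSI_annihilator Q psi.
move=> b; have [q ->] := tensor_diff_generated b.
by rewrite big1 // => i _; rewrite -[v i]mul1r I1 mulr0.
Qed.

End Generators.
End Diagonal.

Theorem theorem3p9 (A B : comPzRingType) (u : {rmorphism A -> B}) :
  finite_type u -> strong_PSI u -> epimorphism u.
Proof.
move=> [s gen_s] psi; apply: epimorphism_of_tensor_diff.
exact: strong_PSI_tensor_diff gen_s psi.
Qed.
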